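(* If $X$ is a non-compact, crowded, separable metrizable space, then $\mathrm{cov}(\mathcal{M})\leq\mathfrak{re}(X)\leq\mathrm{cof}(\mathcal{M})$ and $\min\{\mathrm{non}(\mathcal{M}),\mathfrak{d}\}\leq\mathfrak{re}(X)$.
   Context: A space is crowded if it has no isolated points. For a Tychonoff space $X$, $\beta X$ is its Čech–Stone compactification. A set $F\subset\beta X$ is a remote set of $X$ if $F\cap\mathrm{cl}_{\beta X}(N)=\emptyset$ for every nowhere dense subset $N$ of $X$. For $F\subset\beta X$ closed, its character $\chi(F)$ (in $\beta X$) is the least cardinality of a collection $\mathcal{U}$ of open subsets of $\beta X$ such that $F=\bigcap\{U\in\mathcal{U}:F\subset U\}$. For a non-compact Tychonoff space $X$, $\mathfrak{re}(X)$ is the least cardinal $\kappa$ such that there is a non-empty remote set $F$ of $X$, closed in $\beta X$, with $\chi(F)=\kappa$; if none exists, $\mathfrak{re}(X)=\infty$. $\mathcal{M}$ is the family of all meager subsets of ${}^{\omega}\omega$ (product topology, $\omega$ discrete). $\mathrm{cov}(\mathcal{M})$ is the least cardinality of a subfamily of $\mathcal{M}$ with union ${}^{\omega}\omega$; $\mathrm{cof}(\mathcal{M})$ is the least cardinality of a cofinal subfamily of $\langle\mathcal{M},\subset\rangle$; $\mathrm{non}(\mathcal{M})$ is the least cardinality of a non-meager subset of ${}^{\omega}\omega$; $\mathfrak{d}$ is the least cardinality of a cofinal subset of $\langle{}^{\omega}\omega,\leq^\ast\rangle$, where $f\leq^\ast g$ means $\{n:g(n)<f(n)\}$ is finite. 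*)

(* Defs.v *)
From HB Require Import structures.
From mathcomp Require Import all_boot all_order all_algebra.
From mathcomp Require Import all_classical all_reals all_analysis.
Set Implicit Arguments.
Unset Strict Implicit.
Unset Printing Implicit Defensive.
Import Order.TTheory GRing.Theory Num.Theory.
Import numFieldNormedType.Exports.
Local Open Scope classical_set_scope.
Local Open Scope card_scope.
Local Open Scope ring_scope.

(** A cardinal, possibly infinity: [Some A] stands for the cardinality of [A]
    and [None] for infinity, which lies above every cardinality.  Two cardinals
    are equal when each is below the other; Leibniz equality is not used. *)
Definition xcard (T : Type) : Type := option (set T).

Definition xcard_le (T U : Type) (a : xcard T) (b : xcard U) : Prop :=
  match a, b with
  | _, None => True
  | None, Some _ => False
  | Some A, Some B => A #<= B
  end.

Definition xcard_min (T : Type) (a b : xcard T) : xcard T :=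
  if `[< xcard_le a b >] then a else b.

(** The least element of a class of cardinals, and infinity for the empty
    class; [least_xcardP] shows that a nonempty class has a least element. *)
Definition least_xcard (T : Type) (S : set (xcard T)) : xcard T :=
  xget None [set a | S a /\ forall b, S b -> xcard_le a b].

Lemma card_le_least (T : Type) (P : set (set T)) : P !=set0 ->
  exists2 A, P A & forall B, P B -> A #<= B.
Proof.
move=> [A0 PA0].
(* a maximal set of pairwise nowhere equal choice functions on P exhausts
   some member of P *)
pose Q (E : set (set T -> T)) :=
  (forall e A, E e -> P A -> A (e A)) /\
  (forall e e' A, E e -> E e' -> P A -> e A = e' A -> e = e').
have [F FQ totF|E [[EP Einj] Emax]] := @Zorn_bigcup _ Q.
  split=> [e A [E FE Ee]|e e' A [E FE Ee] [E' FE' Ee'] PA eqA].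
    by have [+ _] := FQ _ FE; apply.
  have [EE'|E'E] := totF _ _ FE FE'.
    by have [_ +] := FQ _ FE'; apply; [exact: EE'|exact: Ee'|exact: PA|].
  by have [_ +] := FQ _ FE; apply; [exact: Ee|exact: E'E|exact: PA|].
have [[A PA sub]|none] :=
    pselect (exists2 A, P A & A `<=` [set e A | e in E]).
  exists A => // B PB.
  have AE : A #<= E := card_le_trans (subset_card_le sub) (card_image_le _ _).
  apply: (card_le_trans AE).
  have injB : {in E &, injective (fun e : set T -> T => e B)}.
    by move=> e e' /set_mem Ee /set_mem Ee'; exact: Einj.
  rewrite -(card_le_eql (inj_card_eq injB)).
  by apply: subset_card_le => _ [e Ee <-]; exact: (EP e B).
have pick A : exists t, P A -> A t /\ ~ [set e A | e in E] t.
  have [PA|nPA] := pselect (P A); last first.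
    have [t _] : exists t, A0 t /\ ~ [set e A0 | e in E] t.
      apply: contrapT => h; apply: none; exists A0 => // t A0t.
      by apply: contrapT => nt; apply: h; exists t.
    by exists t.
  have [t ht] : exists t, A t /\ ~ [set e A | e in E] t.
    apply: contrapT => h; apply: none; exists A => // t At.
    by apply: contrapT => nt; apply: h; exists t.
  by exists t.
have [g gP] := choice pick.
case: (Emax (E `|` [set g])).
  split; first by left.
  by move=> /(_ g (or_intror erefl)) Eg; have [_ []] := gP _ PA0; exists g.
split=> [e A [Ee|->] PA|e e' A [Ee|->] [Ee'|->] PA eqA //].
- exact: (EP e A).
- by have [] := gP _ PA.
- exact: (Einj e e' A).
- by have [_ []] := gP _ PA; exists e.
- by have [_ []] := gP _ PA; exists e'.
Qed.

Lemma least_xcardP (T : Type) (S : set (xcard T)) : S !=set0 ->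
  S (least_xcard S) /\ forall a, S a -> xcard_le (least_xcard S) a.
Proof.
move=> [a0 Sa0]; rewrite /least_xcard.
case: xgetP => [a _ //|/= noleast]; exfalso.
have [[A0 SA0]|noSome] := pselect (exists A, S (Some A)).
  have [A SA Ale] := @card_le_least T [set A | S (Some A)] (ex_intro _ _ SA0).
  by apply: (noleast (Some A)); split=> // -[B|//] /Ale.
apply: (noleast a0); split=> // -[B SB|_]; last by case: (a0).
by case: noSome; exists B.
Qed.

Definition least_card (T : Type) (P : set (set T)) : xcard T :=
  least_xcard (Some @` P).

Definition nowhere_dense (T : topologicalType) (N : set T) : Prop :=
  (closure N)° = set0.

Definition meager (T : topologicalType) (A : set T) : Prop :=
  exists2 N : nat -> set T,
    forall n, nowhere_dense (N n) & A = \bigcup_n N n.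

Definition crowded (T : topologicalType) : Prop := isolated [set: T] = set0.

Definition separable (T : topologicalType) : Prop :=
  exists2 D : set T, countable D & dense D.

Definition metrizable (R : realType) (T : topologicalType) : Prop :=
  exists d : T -> T -> R,
    [/\ forall x y, 0 <= d x y,
        forall x y, d x y = 0 <-> x = y,
        forall x y, d x y = d y x,
        forall x y z, d x z <= d x y + d y z
      & forall x (A : set T),
          nbhs x A <-> exists2 e, 0 < e & [set y | d x y < e] `<=` A].

Definition baire_space : topologicalType := prod_topology (fun _ : nat => nat).

Definition covM : xcard (set baire_space) :=
  least_card [set C | C `<=` @meager baire_space /\
                      \bigcup_(A in C) A = [set: baire_space]].

Definition cofM : xcard (set baire_space) :=
  least_card [set C | C `<=` @meager baire_space /\
                      forall A, meager A -> exists2 B, C B & A `<=` B].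

Definition nonM : xcard baire_space :=
  least_card [set A : set baire_space | ~ meager A].

Definition le_star (f g : baire_space) : Prop :=
  finite_set [set n | (g n < f n)%N].

Definition dominatingN : xcard baire_space :=
  least_card [set D : set baire_space |
    forall f, exists2 g, D g & le_star f g].

Section stone_cech.
Variables (R : realType) (X : topologicalType).

Definition unit_maps : set (X -> R) :=
  [set f : X -> R | continuous f /\ forall x : X, 0 <= f x <= 1].

(** [x] is sent to the family of all [f x], for [f] continuous from [X] to the
    unit interval; the closure of the range of this map lies in the cube. *)
Definition stone_cech_eval (x : X) :
    prod_topology (fun _ : unit_maps => R : topologicalType) :=
  fun f => \val f x.

Definition stone_cech : topologicalType := closure (range stone_cech_eval).

Lemma stone_cech_eval_subproof (x : X) :
  stone_cech_eval x \in closure (range stone_cech_eval).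
Proof. by apply/mem_set/subset_closure; exists x. Qed.

Definition stone_cech_unit (x : X) : stone_cech :=
  exist _ (stone_cech_eval x) (stone_cech_eval_subproof x).

End stone_cech.

Definition remote_set (R : realType) (X : topologicalType)
    (F : set (stone_cech R X)) : Prop :=
  forall N : set X, nowhere_dense N ->
    F `&` closure (@stone_cech_unit R X @` N) = set0.

Definition closed_character (T : topologicalType) (F : set T) :
    xcard (set T) :=
  least_card [set U : set (set T) |
    U `<=` open /\ F = \bigcap_(V in [set V | U V /\ F `<=` V]) V].

Definition re (R : realType) (X : topologicalType) :
    xcard (set (stone_cech R X)) :=
  least_xcard [set closed_character F | F in
    [set F : set (stone_cech R X) | [/\ F !=set0, closed F & remote_set F]]].

(* Main.v *)
Require Import Defs.
From HB Require Import structures.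
From mathcomp Require Import all_boot all_order all_algebra.
From mathcomp Require Import zify lra.
From mathcomp Require Import all_classical all_reals all_analysis.
Set Implicit Arguments.
Unset Strict Implicit.
Unset Printing Implicit Defensive.
Import Order.TTheory GRing.Theory Num.Theory.
Import numFieldNormedType.Exports.
Local Open Scope classical_set_scope.
Local Open Scope card_scope.

(** Why the inequalities hold.

    Lower bounds.  Let [F] be a nonempty closed remote set cut out by a family
    [U] of open sets.  Singletons are nowhere dense, so [F] is disjoint from the
    space, which is therefore the union of an increasing sequence of open sets
    [H n] whose closures miss [F], while every neighbourhood of [F] contains
    points outside every [H n].  Choosing such points in a fixed dense sequence
    gives a function from nat to nat for each neighbourhood.  Conversely, a
    function [g] gives a locally finite, hence nowhere dense, set by collecting
    the points of index less than [g n] outside [H n]; a neighbourhood of [F]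
    that misses this set has a function above [g] at every place.  By
    compactness finite lists of members of [U] provide enough neighbourhoods, so
    that [U], being infinite, bounds the size of a family of functions that
    dominates everywhere ([remote_dominating]).  Such a family is dominating,
    which gives the third inequality, and the sets of all functions below its
    members are nowhere dense and cover the Baire space, which gives the first.

    Upper bound.  Van Douwen's linked systems attach to each closed nowhere
    dense set [D] a continuous function equal to 1 on [D], in such a way that
    finitely many of these functions always have a common zero
    ([remote_functions]); this uses that the space is not compact.  The common
    zeros of their extensions form a nonempty closed remote set, and it suffices
    to use a cofinal family of nowhere dense sets.  A family of the size of a
    cofinal family of meager sets is obtained by coding: a nowhere dense set [N]
    is encoded by a nowhere dense set [code N] of the Baire space such that
    every countable cover of [code N] by nowhere dense sets has a member from
    which, together with a finite sequence, a nowhere dense set containing [N]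
    can be read off ([decode_code]).

    Both directions use that an infinite set has as many finite lists, or pairs
    with natural numbers, as elements. *)

(** * Cardinal arithmetic *)
Lemma card_le_inj (T U : Type) (A : set T) (B : set U) (f : T -> U) :
  (forall x, A x -> B (f x)) ->
  (forall x y, A x -> A y -> f x = f y -> x = y) -> A #<= B.
Proof.
move=> fAB finj; have injf : {in A &, injective f}.
  by move=> x y /set_mem Ax /set_mem Ay; exact: finj.
rewrite -(card_le_eql (inj_card_eq injf)).
by apply: subset_card_le => _ [x Ax <-]; exact: fAB.
Qed.

Lemma card_le_fun (T U : Type) (A : set T) (B : set U) : A !=set0 ->
  A #<= B -> exists f : T -> U, (forall x, A x -> B (f x)) /\
    (forall x y, A x -> A y -> f x = f y -> x = y).
Proof.
elim/Ppointed: U => U in B *.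
  by rewrite [B]emptyE card_le0 => -[x Ax] /eqP A0; rewrite A0 in Ax.
move=> _ /pcard_leP[f]; exists f; split=> [x|x y Ax Ay]; first exact: funS.
by apply: inj; rewrite inE.
Qed.

(** A nonempty countable set is listed by a total function; its members may be
    repeated, so that finite sets are covered as well. *)
Lemma countable_range (T : Type) (A : set T) : A !=set0 -> countable A ->
  exists f : nat -> T, A = range f.
Proof.
move=> A0 Ac; have [a0 Aa0] := A0; have [f [_ finj]] := card_le_fun A0 Ac.
have /choice[h hP] n : exists a, A a /\ forall b, A b -> f b = n -> a = b.
  have [[a Aa <-]|na] := pselect (exists2 a, A a & f a = n).
    by exists a; split=> // b Ab /finj /esym; apply.
  by exists a0; split=> // b Ab fb; case: na; exists b.
exists h; apply/seteqP; split=> [a Aa|_ [n _ <-]]; last by have [] := hP n.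
by exists (f a) => //; have [_ +] := hP (f a); apply.
Qed.

Lemma card_le_setX (T T' U U' : Type) (A : set T) (A' : set T')
    (B : set U) (B' : set U') :
  A #<= B -> A' #<= B' -> A `*` A' #<= B `*` B'.
Proof.
have [->|/set0P A0] := eqVneq A set0; first by rewrite set0X.
have [->|/set0P A'0] := eqVneq A' set0; first by rewrite setX0.
move=> /(card_le_fun A0)[f [fB finj]] /(card_le_fun A'0)[g [gB ginj]].
apply: (@card_le_inj _ _ _ _ (fun x => (f x.1, g x.2))).
  by move=> [x y] [/= Ax Ay]; split; [exact: fB|exact: gB].
by move=> [x y] [x' y'] [/= ? ?] [/= ? ?] [/finj-> // /ginj ->].
Qed.

(** The union embeds into the square of [C], the second coordinate telling
    which of the two embeddings is used. *)
Lemma card_le_setU (T U : Type) (A B : set T) (C : set U) :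
  infinite_set C -> C `*` C #<= C -> A #<= C -> B #<= C -> A `|` B #<= C.
Proof.
move=> Cinf CC.
have [->|/set0P A0] := eqVneq A set0; first by rewrite set0U.
have [->|/set0P B0] := eqVneq B set0; first by rewrite setU0.
move=> /(card_le_fun A0)[f [fC finj]] /(card_le_fun B0)[g [gC ginj]].
apply: card_le_trans CC.
have [h [hC hinj]] := card_le_fun (ex_intro _ 0%N I) ((infiniteP _).1 Cinf).
apply: (@card_le_inj _ _ _ _
  (fun x => if `[< A x >] then (f x, h 0%N) else (g x, h 1%N))).
  move=> x; case: asboolP => [Ax _|nAx [//|Bx]].
    by split; [exact: fC|exact: hC].
  by split; [exact: gC|exact: hC].
move=> x y; case: asboolP => Ax; case: asboolP => Ay.
- by move=> _ _ [] /finj; exact.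
- by move=> _ _ [_ /hinj] /(_ I I).
- by move=> _ _ [_ /hinj] /(_ I I).
- by move=> [//|Bx] [//|By] [] /ginj; exact.
Qed.

Section square.
Variables (T : Type) (A : set T).

Let field (G : set (T * T * T)) : set T :=
  [set x | exists y z, G (x, y, z)].

(** [G] is the graph of an injection of the square of its field into its
    field, which is a part of [A]. *)
Let pairing (G : set (T * T * T)) : Prop :=
  [/\ forall x y z, G (x, y, z) -> [/\ A x, field G y & field G z],
      forall x y, field G x -> field G y -> exists z, G (x, y, z)
    & forall t t', G t -> G t' -> t.1 = t'.1 <-> t.2 = t'.2].

Let pairing_bigcup (F : set (set (T * T * T))) :
  F `<=` pairing -> total_on F subset -> pairing (\bigcup_(G in F) G).
Proof.
move=> Fp Ftot; have fldF G x : F G -> field G x -> field (\bigcup_(G in F) G) x.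
  by move=> FG [y [z Gxyz]]; exists y, z, G.
split=> [x y z [G FG Gxyz]|x y [z [u [G FG Gx]]] [v [w [H FH Hy]]]
  |t t' [G FG Gt] [H FH Ht']].
- by have [/(_ _ _ _ Gxyz)[? ? ?] _ _] := Fp _ FG; split=> //; apply: fldF FG _.
- have [GH|HG] := Ftot _ _ FG FH.
    have [_ Hb _] := Fp _ FH; have [||s Hs] := Hb x y; last by exists s, H.
      by exists z, u; exact: GH.
    by exists v, w.
  have [_ Gb _] := Fp _ FG; have [||s Gs] := Gb x y; last by exists s, G.
    by exists z, u.
  by exists v, w; exact: HG.
- have [GH|HG] := Ftot _ _ FG FH.
    by have [_ _ Hc] := Fp _ FH; exact: (Hc _ _ (GH _ Gt) Ht').
  by have [_ _ Gc] := Fp _ FG; exact: (Gc _ _ Gt (HG _ Ht')).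
Qed.

(** A pairing is extended by a disjoint set [B] by sending all the new pairs
    into [B], which is possible as soon as [B] has room for the whole square. *)
Let pairing_extend (G : set (T * T * T)) (B : set T) :
  pairing G -> B !=set0 -> B `<=` A `\` field G ->
  (field G `|` B) `*` (field G `|` B) #<= B ->
  exists2 H, G `<` H & pairing H.
Proof.
move=> [Ga Gb Gc] [b Bb] BA; set S := field G `|` B => SB.
have Sb : S b by right.
have [q [qB qinj]] := card_le_fun (ex_intro _ (b, b) (conj Sb Sb)) SB.
pose N : set (T * T * T) := [set t | [/\ S t.1.1, S t.1.2,
  ~ (field G t.1.1 /\ field G t.1.2) & t.2 = q t.1]].
have SA x : S x -> A x.
  by move=> [[y [z /Ga[]//]]|/BA[]].
have fldS x : S x -> field (G `|` N) x.
  move=> [[y [z Gx]]|Bx]; first by exists y, z; left.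
  exists x, (q (x, x)); right; split=> //=; [by right|by right|].
  by case=> xG _; case: (BA _ Bx).
exists (G `|` N).
  split; first by move=> t; left.
  move=> /(_ (b, b, q (b, b))) NG; have [_ bG] := BA _ Bb; apply: bG.
  exists b, (q (b, b)); apply: NG; right; split=> //=.
  by case=> bG _; case: (BA _ Bb).
split.
- move=> x y z [/Ga[Ax Gy Gz]|[/= Sx Sy _ ->]].
    by split=> //; apply: fldS; left.
  split; [exact: SA|exact: fldS|apply: fldS; right].
  by apply: (qB (x, y)).
- move=> x y xH yH.
  have HS z : field (G `|` N) z -> S z.
    by move=> [u [v [Gz|[]//]]]; left; exists u, v.
  have [[Gx Gy]|nG] := pselect (field G x /\ field G y).
    by have [z Gz] := Gb _ _ Gx Gy; exists z; left.
  by exists (q (x, y)); right; split=> //=; exact: HS.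
- have mixed t t' : G t -> N t' -> (t.1 = t'.1 <-> t.2 = t'.2).
    move: t t' => [[x y] z] [[x' y'] z'] Gt [/= Sx' Sy' nG zE].
    have [_ Gy Gz] := Ga _ _ _ Gt; split=> [[xE yE]|zz'].
      by case: nG; split; [rewrite -xE; exists y, z|rewrite -yE].
    have /BA[_ []] : B z' by rewrite zE; exact: (qB (x', y')).
    by rewrite -zz'.
  move=> t t' [Gt|Nt] [Gt'|Nt'].
  + exact: Gc.
  + exact: mixed.
  + by split=> /esym /(mixed _ _ Gt' Nt).
  + move: Nt Nt' => [St1 St2 _ ->] [St1' St2' _ ->]; split=> [->//|].
    by apply: qinj.
Qed.

(** The field [C] of a maximal pairing is as large as [A]: otherwise the
    complement of [C] contains either a countable set, when [C] is finite, or a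
    copy of [C], and the pairing extends to that set. *)
Lemma card_setX_infinite : infinite_set A -> A `*` A #<= A.
Proof.
move=> Ainf; have [G [Gp Gmax]] := Zorn_bigcup pairing_bigcup.
have noext B : B !=set0 -> B `<=` A `\` field G ->
    ~ ((field G `|` B) `*` (field G `|` B) #<= B).
  by move=> B0 BA SB; have [H GH /(Gmax _ GH)] := pairing_extend Gp B0 BA SB.
have [Ga Gb Gc] := Gp; set C := field G in noext Ga Gb.
have CA : C `<=` A by move=> x [y [z /Ga[]]].
have Cinf : infinite_set C.
  move=> Cfin; have /infiniteP Dinf := infinite_setD Ainf Cfin.
  have [f [fD finj]] := card_le_fun (ex_intro _ 0%N I) Dinf.
  apply: (noext (range f)).
  - by exists (f 0%N), 0%N.
  - by move=> _ [n _ <-]; apply: fD.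
  have cR : countable (range f).
    by apply: sub_countable (card_image_le _ _) (countableP _).
  have cS : countable (C `|` range f).
    rewrite -bigcup2E; apply: bigcup_countable => // -[|[|n]] _ //=.
    exact: finite_set_countable.
  apply: (card_le_trans (countableX cS cS)).
  apply: (@card_le_inj _ _ _ _ f) => [n _|m n _ _]; first by exists n.
  by apply: finj.
have [c0 Cc0] := infinite_setN0 Cinf.
have CC : C `*` C #<= C.
  have /choice[q qP] (t : T * T) : exists z, C t.1 -> C t.2 -> G (t, z).
    have [[/Gb + /[dup] Ct]|n] := pselect (C t.1 /\ C t.2); last first.
      by exists c0 => *; case: n.
    by move=> /[apply] -[z]; exists z; case: t {Ct} p.
  apply: (@card_le_inj _ _ _ _ q).
    by move=> [x y] [/= Cx Cy]; have /Ga[] := qP (x, y) Cx Cy.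
  move=> t t' [Ct1 Ct2] [Ct1' Ct2'] qE.
  by have /= -> := Gc _ _ (qP t Ct1 Ct2) (qP t' Ct1' Ct2').
have ACC : A `\` C #<= C -> A `*` A #<= A.
  move=> DC; have AC : A #<= C.
    rewrite -(setDUK CA); exact: card_le_setU.
  apply: card_le_trans (card_le_setX AC AC) (card_le_trans CC _).
  exact: subset_card_le.
have [_ [->|->] least] := @card_le_least T [set A `\` C; C]
    (ex_intro _ C (or_intror erefl)); first by apply/ACC/least; right.
have CD : C #<= A `\` C by apply: least; left.
have [f [fD finj]] := card_le_fun (ex_intro _ c0 Cc0) CD.
have CI : C #<= f @` C.
  by apply: (@card_le_inj _ _ _ _ f) => // x Cx; exists x.
case: (noext (f @` C)).
- by exists (f c0), c0.
- by move=> _ [x Cx <-]; exact: fD.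
apply: (card_le_trans _ CI); apply: (card_le_trans _ CC).
have SC : C `|` f @` C #<= C.
  exact: card_le_setU Cinf CC (card_lexx _) (card_image_le _ _).
exact: card_le_setX.
Qed.

End square.

Lemma card_seq_infinite (T : eqType) (A : set T) : infinite_set A ->
  [set l : seq T | forall x, x \in l -> A x] #<= A.
Proof.
move=> Ainf.
have [e [eA einj]] := card_le_fun (ex_intro _ 0%N I) ((infiniteP _).1 Ainf).
have [p [pA pinj]] := card_le_fun (ex_intro _ (e 0%N, e 0%N)
  (conj (eA 0%N I) (eA 0%N I))) (card_setX_infinite Ainf).
pose code := foldr (fun x y => p (x, y)) (e 0%N).
have code1 x l : (forall y, y \in x :: l -> A y) ->
    A x /\ forall y, y \in l -> A y.
  by move=> Al; split=> [|y yl]; apply: Al; rewrite inE ?eqxx ?yl ?orbT.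
have codeA l : (forall x, x \in l -> A x) -> A (code l).
  elim: l => [_|x l IH /code1[Ax /IH Al]]; first exact: eA.
  exact: (pA (x, code l)).
(* lists of equal length are determined by their code alone *)
have codeinj l l' : (forall x, x \in l -> A x) -> (forall x, x \in l' -> A x) ->
    size l = size l' -> code l = code l' -> l = l'.
  elim: l l' => [|x l IH] [|x' l'] //= /code1[Ax Al] /code1[Ax' Al'] [szE].
  have AxA : (A `*` A) (x, code l) by split=> //; exact: codeA.
  have AxA' : (A `*` A) (x', code l') by split=> //; exact: codeA.
  by move=> /(pinj _ _ AxA AxA')[-> /(IH _ Al Al' szE)->].
have AeA l : (forall x, x \in l -> A x) -> (A `*` A) (e (size l), code l).
  by move=> Al; split=> /=; [exact: eA|exact: codeA].
apply: (@card_le_inj _ _ _ _ (fun l => p (e (size l), code l))) => [l Al|].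
  exact/pA/AeA.
move=> l l' Al Al' /(pinj _ _ (AeA _ Al) (AeA _ Al'))[/(einj _ _ I I)].
exact: codeinj.
Qed.

Lemma card_setX_nat (T : Type) (A : set T) : infinite_set A ->
  A `*` [set: nat] #<= A.
Proof.
move=> Ainf; apply: card_le_trans (card_setX_infinite Ainf).
exact/card_le_setX/infiniteP.
Qed.

(** * Meager sets of the Baire space *)
Section nowhere_dense_sets.
Variable T : topologicalType.
Implicit Types (N V W : set T).

Lemma nowhere_denseP N : nowhere_dense N <->
  forall V, open V -> V !=set0 ->
    exists2 W, open W & [/\ W !=set0, W `<=` V & W `&` N = set0].
Proof.
split=> [Nnwd V Vo [v Vv]|escape].
  have [VN|/existsNP[z /not_implyP[Vz nNz]]] := pselect (V `<=` closure N).
    have : (closure N)° v by apply: (filterS VN); exact: open_nbhs_nbhs.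
    by rewrite Nnwd.
  exists (V `&` ~` closure N).
    by apply: openI => //; apply: closed_openC; exact: closed_closure.
  split; [by exists z|by move=> ? []|].
  by apply/seteqP; split=> // x [[_ nNx] Nx]; apply: nNx; exact: subset_closure.
apply/seteqP; split=> // x /= xN.
have [W Wo [[w Ww] WN WN0]] :=
  escape _ (@open_interior _ (closure N)) (ex_intro _ x xN).
have := interior_subset (WN _ Ww) W (open_nbhs_nbhs (conj Wo Ww)).
by rewrite setIC WN0 => -[].
Qed.

End nowhere_dense_sets.

Section baire.
Implicit Types (s t : seq nat) (y z : baire_space) (A : set baire_space).

Definition cylinder s : set baire_space :=
  [set y | forall i, (i < size s)%N -> y i = nth 0%N s i].

Lemma cylinder_cat s t : cylinder (s ++ t) `<=` cylinder s.
Proof.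
by move=> y ys i lt_i; rewrite ys ?nth_cat ?lt_i // size_cat ltn_addr.
Qed.

Lemma cylinder_nth s : cylinder s (nth 0%N s).
Proof. by []. Qed.

Lemma mkseq_cylinder s y : cylinder s y -> mkseq y (size s) = s.
Proof.
move=> ys; apply: (@eq_from_nth _ 0%N); rewrite size_mkseq // => i lti.
by rewrite nth_mkseq // ys.
Qed.

Lemma nbhs_cylinder y A :
  nbhs y A <-> exists n, cylinder (mkseq y n) `<=` A.
Proof.
have nat_nbhs (n : nat) : nbhs n [set n] by rewrite nbhs_principalE.
split.
  pose F := filter_from [set: nat] (fun n => cylinder (mkseq y n)).
  have FF : Filter F.
    apply: filter_from_filter; first by exists 0%N.
    move=> m n _ _; exists (maxn m n) => // z.
    rewrite /cylinder /= !size_mkseq => zy.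
    by split=> i lti; rewrite zy ?nth_mkseq // leq_max lti ?orbT.
  suff Fy : F --> y by move=> /Fy[n _ nA]; exists n.
  apply/cvg_sup => i V [W [[U _ <-] Uy WV]].
  exists i.+1 => // z zy; apply: WV; rewrite /= in Uy *.
  by have := zy i; rewrite size_mkseq nth_mkseq // => ->.
move=> [n nA]; apply: (filterS nA).
suff yn : nbhs y [set z : baire_space | forall i, (i < n)%N -> z i = y i].
  apply: (filterS _ yn) => z zy i; rewrite size_mkseq => ltin.
  by rewrite nth_mkseq ?zy.
elim: n {nA} => [|n IH]; first by apply: (filterS _ filterT).
have yn : nbhs y [set z : baire_space | z n = y n].
  exact: (@proj_continuous nat (fun=> nat) n y _ (nat_nbhs (y n))).
move: (@filterI _ _ (nbhs_filter y) _ _ yn IH); apply: filterS => z [/= zyn zy] i.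
by rewrite ltnS leq_eqVlt => /predU1P[->|/zy].
Qed.

Lemma cylinder_open s : open (cylinder s).
Proof.
rewrite openE => y ys; apply/nbhs_cylinder; exists (size s).
by rewrite mkseq_cylinder.
Qed.

Lemma open_cylinder A y : open A -> A y -> exists n, cylinder (mkseq y n) `<=` A.
Proof. by move=> Ao Ay; apply/nbhs_cylinder; exact: open_nbhs_nbhs. Qed.

(** Nowhere density in the combinatorial form used by every construction of a
    branch: each finite sequence extends to one whose cylinder avoids [A]. *)
Lemma nowhere_dense_cylinder A : nowhere_dense A <->
  forall s, exists t, cylinder (s ++ t) `&` A = set0.
Proof.
split=> [/nowhere_denseP Anwd s|escape].
  have [W Wo [[y Wy] Ws WA]] := Anwd _ (cylinder_open s) 
    (ex_intro _ _ (@cylinder_nth s)).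
  have [n nW] := open_cylinder Wo Wy.
  exists (drop (size s) (mkseq y n)); rewrite -subset0 -WA; apply: setSI => z zy.
  apply: nW => i lti; have sE := mkseq_cylinder (Ws _ Wy).
  rewrite zy; last first.
    by rewrite size_cat size_drop; move: lti; rewrite size_mkseq; lia.
  rewrite nth_cat; case: ltnP => ltis.
    by rewrite -(Ws _ Wy) // nth_mkseq //; move: lti; rewrite size_mkseq.
  by rewrite nth_drop subnKC.
apply/nowhere_denseP => V Vo [y Vy]; have [n nV] := open_cylinder Vo Vy.
have [t tA] := escape (mkseq y n).
exists (cylinder (mkseq y n ++ t)); first exact: cylinder_open.
split=> //; first by exists (nth 0%N (mkseq y n ++ t)); exact: cylinder_nth.
by apply: subset_trans nV; exact: cylinder_cat.
Qed.

(** The Baire category theorem for the branches of a tree [P] of finite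
    sequences: dodging the sets [E k] one at a time inside the tree builds a
    branch outside all of them. *)
Lemma baire_branch (P : seq nat -> Prop) (E : nat -> set baire_space) :
  P [::] -> (forall s t, P (s ++ t) -> P s) ->
  (forall s k, P s -> exists t, [/\ (0 < size t)%N, P (s ++ t) &
     cylinder (s ++ t) `&` E k = set0]) ->
  exists2 y : baire_space, forall n, P (mkseq y n) & forall k, ~ E k y.
Proof.
move=> P0 Pcat dodge.
have /choice[g gP] (sk : seq nat * nat) : exists t, P sk.1 ->
    [/\ (0 < size t)%N, P (sk.1 ++ t) & cylinder (sk.1 ++ t) `&` E sk.2 = set0].
  have [/(dodge _ sk.2)[t tP]|nP] := pselect (P sk.1); first by exists t.
  by exists [::].
pose s := fix s k := if k is j.+1 then s j ++ g (s j, j) else [::].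
have sP k : P (s k) by elim: k => //= k sPk; have [] := gP (s k, k) sPk.
have size_s k : (k <= size (s k))%N.
  elim: k => //= k IH; have [g0 _ _] := gP (s k, k) (sP k).
  by rewrite size_cat /=; lia.
have s_le j k : (j <= k)%N -> exists t, s k = s j ++ t.
  elim: k => [|k IH]; first by rewrite leqn0 => /eqP ->; exists [::].
  rewrite leq_eqVlt => /predU1P[->|]; first by exists [::]; rewrite cats0.
  by rewrite ltnS => /IH[t /= ->]; exists (t ++ g (s j ++ t, k)); rewrite catA.
pose y : baire_space := fun i => nth 0%N (s i.+1) i.
have ys k : cylinder (s k) y.
  move=> i lti; rewrite /y; have [/s_le[t ->]|/ltnW/s_le[t ->]] := leqP i.+1 k.
    by rewrite nth_cat size_s.
  by rewrite nth_cat lti.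
exists y => [n|k Eky].
  apply: (Pcat _ (drop n (s n))); suff <- : take n (s n) = mkseq y n.
    by rewrite cat_take_drop.
  apply: (@eq_from_nth _ 0%N); rewrite ?size_mkseq size_takel // => i ltin.
  by rewrite nth_take // nth_mkseq // (ys n) // (leq_trans ltin).
have [_ _ yE] := gP (s k, k) (sP k).
have : (cylinder (s k ++ g (s k, k)) `&` E k) y by split=> //; exact: (ys k.+1).
by rewrite yE.
Qed.

(** The Baire category theorem is [baire_branch] for the full tree. *)
Lemma baire_not_meager A : meager A -> A <> [set: baire_space].
Proof.
move=> [N Nnwd ->] NT.
have [||s k _|y _ yN] := @baire_branch (fun=> True) N => //.
  have /nowhere_dense_cylinder/(_ (rcons s 0%N))[t tN] := Nnwd k.
  by exists (0%N :: t); rewrite -cat_rcons.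
by have [n _ /yN] : (\bigcup_n N n) y by rewrite NT.
Qed.

Lemma meager_bigcup (A : nat -> set baire_space) :
  (forall n, meager (A n)) -> meager (\bigcup_n A n).
Proof.
move=> Am; have /choice[N NP] n : exists N : nat -> set baire_space,
    (forall k, nowhere_dense (N k)) /\ A n = \bigcup_k N k.
  by have [N ? ?] := Am n; exists N.
pose D k := if unpickle k is Some (m, n) then N m n else set0.
exists D => [k|].
  rewrite /D; case: unpickle => [[m n]|]; first by have [] := NP m.
  by apply/nowhere_dense_cylinder => s; exists [::]; rewrite setI0.
apply/seteqP; split=> y.
  move=> [m _]; have [_ ->] := NP m => -[n _ yN].
  by exists (pickle (m, n)) => //; rewrite /D pickleK.
move=> [k _]; rewrite /D; case: unpickle => [[m n]|//] yN; exists m => //.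
by have [_ ->] := NP m; exists n.
Qed.

(** A countable cofinal family would have a meager union, which contains every
    point since singletons are meager. *)
Lemma cofinal_meager_infinite (C : set (set baire_space)) :
  C `<=` @meager baire_space ->
  (forall A, meager A -> exists2 B, C B & A `<=` B) -> infinite_set C.
Proof.
move=> Cm Ccof /finite_set_countable Cc.
have m0 : meager (set0 : set baire_space).
  exists (fun=> set0); last by rewrite bigcup0.
  by move=> _; apply/nowhere_dense_cylinder => s; exists [::]; rewrite setI0.
have [B0 CB0 _] := Ccof _ m0.
have [f fC] := countable_range (ex_intro _ _ CB0) Cc.
apply: (baire_not_meager (meager_bigcup (fun n => _ : meager (f n)))).
  by move=> n; apply: Cm; rewrite fC; exists n.
apply/seteqP; split=> // y _.
have m1 : meager [set y].
  exists (fun=> [set y]); last by rewrite bigcup_const.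
  move=> _; apply/nowhere_dense_cylinder => s; exists [:: (y (size s)).+1].
  apply/seteqP; split=> // z [zs zy]; have := zs (size s).
  by rewrite zy size_cat addn1 ltnSn nth_cat ltnn subnn /= => /(_ isT); lia.
have [B + yB] := Ccof _ m1; rewrite fC => -[n _ fn]; exists n => //.
by rewrite fn; exact: yB.
Qed.

End baire.

(** * Coding nowhere dense sets by meager sets

    A digit [j] asks to shrink an open set [W] to the basic set [B j./2]; the
    parity of [j] is only read when the shrunken set misses [N], a situation
    called an exit.  The code of [N] is the set of all infinite sequences of
    digits whose exits are all even, where each even exit starts the shrinking
    again from the whole space.  Odd exits make the code nowhere dense.  Even
    exits make it self-similar: below each node there is a node at which the
    process starts afresh, so that any portion of the code retains complete
    information on [N]. *)
Section nowhere_dense_code.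
Variables (X : topologicalType) (B : nat -> set X).
Hypotheses (X0 : [set: X] !=set0) (Bo : forall j, open (B j)).
Hypothesis Bpi : forall V : set X, open V -> V !=set0 ->
  exists2 j, B j !=set0 & B j `<=` V.
Implicit Types (N W : set X) (s t : seq nat).

Definition refine W j : set X :=
  if `[< B j./2 !=set0 /\ B j./2 `<=` W >] then B j./2 else W.

Definition cell s : set X := foldl refine [set: X] s.

Definition code_step N (o : option (set X)) j : option (set X) :=
  if o is Some W then
    if `[< refine W j `&` N !=set0 >] then Some (refine W j)
    else if odd j then None else Some [set: X]
  else None.

(** [None] means that an odd exit has occurred; [Some W] means that the digits
    read since the last even exit have shrunk the space to [W]. *)
Definition code_state N s : option (set X) :=
  foldl (code_step N) (Some [set: X]) s.

Definition code N : set baire_space :=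
  [set y | forall n, code_state N (mkseq y n) <> None].

(** The cells [cell s] for which [A] misses the cylinder of [t ++ s] form a
    dense open set when [A] is nowhere dense.  If [t] ends with an even exit,
    the states reached by [code_state N] after [t] are those reached from the
    start, so that all these cells miss [N] as soon as [A] contains the part of
    [code N] beyond [t]. *)
Definition decode (A : set baire_space) t : set X :=
  ~` \bigcup_(s in [set s | cylinder (t ++ s) `&` A = set0]) cell s.

Let code_step_cat N s t :
  code_state N (s ++ t) = foldl (code_step N) (code_state N s) t.
Proof. by rewrite /code_state foldl_cat. Qed.


Let foldl_None N s : foldl (code_step N) None s = None.
Proof. by elim: s. Qed.

Let refine_sub W j : refine W j `<=` W.
Proof. by rewrite /refine; case: asboolP => [[]|_ x]. Qed.

Let foldl_refine_sub W s : foldl refine W s `<=` W.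
Proof.
by elim: s W => [|j s IH] W x //= /IH /refine_sub.
Qed.

Let cell_cat s t : cell (s ++ t) `<=` cell s.
Proof. by rewrite /cell foldl_cat; exact: foldl_refine_sub. Qed.

Let refine_open W j :
  open W /\ W !=set0 -> open (refine W j) /\ refine W j !=set0.
Proof. by rewrite /refine; case: asboolP => [[? ?] _|]. Qed.

Let cell_open s : open (cell s) /\ cell s !=set0.
Proof.
rewrite /cell; have : open [set: X] /\ [set: X] !=set0.
  by split=> //; exact: openT.
by elim: s [set: X] => [|j s IH] W Wo //=; apply: IH; exact: refine_open.
Qed.

Let code_state_open N s W : code_state N s = Some W -> open W /\ W !=set0.
Proof.
elim/last_ind: s W => [|s j IH] W; first by case=> <-; split=> //; exact: openT.
rewrite /code_state -cats1 foldl_cat -/(code_state N s) /=.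
case: (code_state N s) IH => //= V /(_ V erefl) Vo.
case: asboolP => _; first by case=> <-; exact: refine_open.
by case: odd => // -[<-]; split=> //; exact: openT.
Qed.

(** The sets met before reaching [cell s] all contain [x], hence no exit
    occurs. *)
Let code_state_hit N s x : N x -> cell s x -> code_state N s = Some (cell s).
Proof.
move=> Nx; elim/last_ind: s => // s j IH; rewrite -cats1 => sx.
rewrite code_step_cat IH /=; last exact: cell_cat sx.
rewrite /cell foldl_cat /= in sx *; case: asboolP => // -[].
by exists x.
Qed.

(** Both digits that ask for a basic set disjoint from [N] are exits, and they
    have opposite parities. *)
Let exit_digit N W (b : bool) : nowhere_dense N -> open W -> W !=set0 ->
  exists2 j, odd j = b & refine W j `&` N = set0.
Proof.
move=> /nowhere_denseP Nnwd Wo W0; have [V Vo [V0 VW VN]] := Nnwd W Wo W0.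
have [j Bj0 BjV] := Bpi Vo V0; exists (b + j.*2)%N.
  by rewrite oddD odd_double addbF; case: b.
rewrite -subset0 -VN; apply: setSI; rewrite /refine half_bit_double.
by case: asboolP => // -[]; split=> //; exact: subset_trans VW.
Qed.

Lemma code_nowhere_dense N : nowhere_dense N -> nowhere_dense (code N).
Proof.
move=> Nnwd; apply/nowhere_dense_cylinder => s.
have dead t : code_state N t = None -> cylinder t `&` code N = set0.
  move=> tN; apply/seteqP; split=> // y [/mkseq_cylinder yt /(_ (size t))].
  by rewrite yt.
case sN: (code_state N s) => [W|]; last first.
  by exists [::]; rewrite cats0; exact: dead.
have [Wo W0] := code_state_open sN.
have [j jodd jN] := exit_digit true Nnwd Wo W0.
exists [:: j]; apply: dead; rewrite code_step_cat sN /=.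
by case: asboolP => [[x]|_]; [rewrite jN|rewrite jodd].
Qed.

Lemma decode_nowhere_dense A t : nowhere_dense A -> nowhere_dense (decode A t).
Proof.
move=> /nowhere_dense_cylinder Anwd; apply/nowhere_denseP => V Vo V0.
have [j Bj0 BjV] := Bpi Vo V0; have [s sA] := Anwd (t ++ [:: j.*2]).
rewrite -catA in sA; have [Co C0] := cell_open (j.*2 :: s).
exists (cell (j.*2 :: s)) => //; split=> //.
  apply: subset_trans BjV; apply: (subset_trans (@cell_cat [:: j.*2] s)).
  rewrite /cell /= /refine doubleK.
  by case: asboolP => [_ //|[]]; split.
apply/seteqP; split=> // x [sx]; apply; exists (j.*2 :: s) => //.
Qed.

Lemma decode_closed A t : closed (decode A t).
Proof.
by apply: open_closedC; apply: bigcup_open => s _; have [] := cell_open s.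
Qed.

(** If there were no such [k] and [t], each node of the tree of [code N] could be
    extended, through an even exit and then a cell meeting [N], so as to miss
    [A k]; the branch obtained would lie in [code N] and outside all the sets
    [A k]. *)
Lemma decode_code N (A : nat -> set baire_space) : nowhere_dense N ->
  code N `<=` \bigcup_k A k -> exists k t, N `<=` decode (A k) t.
Proof.
move=> Nnwd NA; apply: contrapT => nodec.
have [|s t|s k|y yN yA] :=
  @baire_branch (fun s => code_state N s <> None) A => //.
- by rewrite code_step_cat; case: (code_state N s) => //; rewrite foldl_None.
- case sN: (code_state N s) => [W|] // _.
  have [Wo W0] := code_state_open sN.
  have [j jeven jN] := exit_digit false Nnwd Wo W0.
  have st : code_state N (rcons s j) = Some [set: X].
    rewrite -cats1 code_step_cat sN /=.
    by case: asboolP => [[x]|_]; [rewrite jN|rewrite jeven].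
  have [x [Nx /contrapT[t tA tx]]] :
      exists x, N x /\ ~ decode (A k) (rcons s j) x.
    apply: contrapT => nx; apply: nodec; exists k, (rcons s j) => x Nx.
    by apply: contrapT => nxd; apply: nx; exists x.
  exists (j :: t); split=> //; last by rewrite -cat_rcons.
  rewrite -cat_rcons code_step_cat st; have := code_state_hit Nx tx.
  by rewrite /code_state => ->.
- by have [k _ /yA] := NA y yN.
Qed.

End nowhere_dense_code.

(** * Separable metrizable spaces *)
Section metrizable_spaces.
Variables (R : realType) (X : topologicalType).
Local Open Scope ring_scope.

Lemma separable_sequence : [set: X] !=set0 -> separable X ->
  exists x : nat -> X, forall V, open V -> V !=set0 -> exists j, V (x j).
Proof.
move=> X0 [D Dc Dd].
have [p Dp] : D !=set0.
  by have := Dd setT X0 openT; rewrite setTI => -[p]; exists p.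
have [x Dx] := countable_range (ex_intro _ _ Dp) Dc.
exists x => V Vo V0; have [v [Vv]] := Dd V V0 Vo.
by rewrite Dx => -[j _ xj]; exists j; rewrite xj.
Qed.

Hypothesis metX : metrizable R X.

Lemma metrizable_closed_set1 (x : X) : closed [set x].
Proof.
have [d [d_ge0 d0 dC dtri nbhsd]] := metX.
move=> y yx; apply: contrapT => nyx.
have dyx : 0 < d y x.
  by rewrite lt_neqAle d_ge0 andbT; apply/eqP => /esym /d0 /esym /esym.
have /yx[_ [-> /=]] : nbhs y [set z | d y z < d y x].
  by apply/nbhsd; exists (d y x).
by rewrite ltxx.
Qed.

(** Two disjoint closed sets are separated by the unions of the balls whose
    radii are half the distance of their centres to the other set. *)
Lemma metrizable_normal : normal_space X.
Proof.
have [d [d_ge0 d0 dC dtri nbhsd]] := metX.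
have dxx x : d x x = 0 by apply/d0.
have ball_open x e : open [set y | d x y < e].
  rewrite openE => y /= dxy; apply/nbhsd; exists (e - d x y); first lra.
  by move=> z /= dyz; have := dtri x y z; lra.
have away (A : set X) x : closed A -> ~ A x ->
    exists2 e, 0 < e & forall y, A y -> e <= d x y.
  move=> Acl nAx; have : nbhs x (~` A).
    by apply: open_nbhs_nbhs; split=> //; exact: closed_openC.
  move=> /nbhsd[e e0 eA]; exists e => // y Ay; rewrite leNgt; apply/negP => /eA.
  exact.
apply/(@normal_openP R) => A B Acl Bcl AB.
have halo (C D : set X) : closed D -> C `&` D = set0 -> exists r : X -> R,
    forall x, C x -> 0 < r x /\ forall y, D y -> r x <= d x y.
  move=> Dcl CD; suff /choice[r rP] x :
      exists e, C x -> 0 < e /\ forall y, D y -> e <= d x y.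
    by exists r.
  have [Cx|nCx] := pselect (C x); last by exists 0.
  have [|e ? ?] := away D x Dcl; last by exists e.
  by move=> Dx; have : (C `&` D) x by []; rewrite CD.
have [r rP] := halo A B Bcl AB.
have [s sP] := halo B A Acl (etrans (setIC _ _) AB).
exists (\bigcup_(x in A) [set y | d x y < r x / 2]).
exists (\bigcup_(x in B) [set y | d x y < s x / 2]); split.
- by apply: bigcup_open => x _.
- by apply: bigcup_open => x _.
- by move=> x Ax; exists x => //=; rewrite dxx; have [] := rP x Ax; lra.
- by move=> x Bx; exists x => //=; rewrite dxx; have [] := sP x Bx; lra.
apply/seteqP; split=> // z [[x Ax /= dxz] [y By /= dyz]].
have [_ /(_ _ By)] := rP x Ax; have [_ /(_ _ Ax)] := sP y By.
by rewrite [d y x]dC; have := dtri x z y; rewrite [d z y]dC; lra.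
Qed.

(** The balls of radius [m.+1^-1] about the points of a dense sequence form such
    a base: the closure of the ball about [p k] lies within [3 / m.+1] of each of
    its points [x]. *)
Lemma metrizable_base : [set: X] !=set0 -> separable X ->
  exists2 B : nat -> set X, forall j, open (B j) &
    forall x V, nbhs x V -> exists2 j, B j x & closure (B j) `<=` V.
Proof.
move=> X0 /(separable_sequence X0)[p pd].
have [d [d_ge0 d0 dC dtri nbhsd]] := metX.
have ball_open x e : open [set y | d x y < e].
  rewrite openE => y /= dxy; apply/nbhsd; exists (e - d x y); first lra.
  by move=> z /= dyz; have := dtri x y z; lra.
pose B j := if unpickle j is Some (k, m) then
  [set y | d (p k) y < m.+1%:R^-1] else set0.
exists B => [j|x V /nbhsd[e e0 eV]].
  by rewrite /B; case: unpickle => [[k m]|]; [exact: ball_open|exact: open0].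
have [m me] : exists m : nat, m.+1%:R^-1 < e / 3.
  have e30 : 0 < e / 3 by lra.
  have [m _ mP] := @near_infty_natSinv_lt R (PosNum e30).
  by exists m; exact: mP (leqnn m).
have [k xk] : exists k, d x (p k) < m.+1%:R^-1.
  by apply: (pd _ (ball_open x m.+1%:R^-1)); exists x => /=; rewrite (d0 x x).2.
exists (pickle (k, m)); rewrite /B pickleK; first by rewrite /= dC.
move=> y yB; apply: eV => /=.
have /yB[z [/= kz yz]] : nbhs y [set z | d y z < m.+1%:R^-1].
  by apply/nbhsd; exists m.+1%:R^-1.
have := dtri x (p k) y; have := dtri (p k) z y; rewrite [d z y]dC.
move: kz yz xk me; move: m.+1%:R^-1 => q; lra.
Qed.

(** Locally [E] is finite, and a finite set can be removed from a nonempty open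
    set without exhausting it, since singletons are closed and not open. *)
Lemma crowded_nowhere_dense (E : set X) : crowded X ->
  (forall x : X, exists2 V : set X, nbhs x V & finite_set (V `&` E)) ->
  nowhere_dense E.
Proof.
move=> crX Efin; apply/nowhere_denseP => V Vo [v Vv].
have avoid (s : seq X) W : open W -> W !=set0 -> exists2 W', open W' &
    [/\ W' !=set0, W' `<=` W & forall x, x \in s -> ~ W' x].
  move=> Wo W0; elim: s => [|a s [W' W'o [[w W'w] W'W W's]]].
    by exists W => //; split.
  exists (W' `&` ~` [set a]).
    by apply: openI => //; apply: closed_openC; exact: metrizable_closed_set1.
  split; last by move=> x; rewrite inE =>
    /predU1P[-> [_ /(_ erefl)]|/W's nW' [/nW']].
    apply: contrapT => W'a; have : isolated [set: X] w.
      split; first by rewrite inE.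
      exists W'; first exact: open_nbhs_nbhs.
      have W'1 x : W' x -> x = a.
        by move=> W'x; apply: contrapT => xa; apply: W'a; exists x.
      rewrite setIT; apply/seteqP; split=> [x W'x|_ ->//].
      by rewrite (W'1 x) // (W'1 w).
    by rewrite crX.
  by move=> x [/W'W].
have [U Uv UE] := Efin v; have [s sE] := (finite_seqP _).1 UE.
have [||W Wo [W0 WVU Ws]] := avoid s (V `&` U°).
- by apply: openI => //; exact: open_interior.
- by exists v; split.
exists W => //; split=> // [x /WVU[]//|].
apply/seteqP; split=> // x [Wx Ex]; apply: (Ws x) => //.
suff : [set` s] x by [].
by rewrite -sE; split=> //; have [_ /interior_subset] := WVU x Wx.
Qed.

End metrizable_spaces.

(** * Remote families of functions *)
Section remote_functions.
Variables (R : realType) (X : topologicalType) (B : nat -> set X).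
Hypothesis Bo : forall j, open (B j).
Hypothesis Bbase : forall x V,
  nbhs x V -> exists2 j, B j x & closure (B j) `<=` V.

(** A proper filter [F] without cluster points contains the complements of the
    closures of enough basic sets to cover the space; [O n] intersects those that
    come from the first [n] basic sets, and thus belongs to [F]. *)
Lemma noncompact_vanishing : ~ compact [set: X] ->
  exists O : nat -> set X, (forall n, open (O n) /\ O n !=set0) /\
    forall x : X, exists2 V : set X, nbhs x V &
      exists m, forall n, (m <= n)%N -> V `&` O n = set0.
Proof.
move=> /existsNP[F /not_implyP[FF /not_implyP[_ Fncl]]].
have far (x : X) : exists2 j, B j x & F (~` closure (B j)).
  have : ~ cluster F x by move=> Fx; apply: Fncl; exists x.
  move=> /existsNP[A /existsNP[V /not_implyP[FA /not_implyP[Vx AV]]]].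
  have [j Bjx BjV] := Bbase Vx; exists j => //.
  by apply: filterS FA => a Aa /BjV Va; apply: AV; exists a.
pose O := fix O n := if n is j.+1 then
  if `[< F (~` closure (B j)) >] then O j `&` ~` closure (B j) else O j
  else [set: X].
have OS n : O n.+1 `<=` O n by rewrite /=; case: asboolP => [_ x []//|_ x //].
have FO n : F (O n).
  elim: n => [|n IH] /=; first exact: filterT.
  by case: asboolP => // ?; exact: filterI.
exists O; split=> [n|x].
  split; last exact: filter_ex (FO n).
  elim: n => [|n IH] /=; first exact: openT.
  case: asboolP => // _; apply: openI => //.
  by apply: closed_openC; exact: closed_closure.
have [j Bjx Fj] := far x; exists (B j); first exact: open_nbhs_nbhs.
exists j.+1 => n; elim: n => // n IH; rewrite leq_eqVlt => /predU1P[[<-]|/IH jO].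
  rewrite /=; case: asboolP => // _; apply/seteqP; split=> // z [Bjz [_]].
  by apply; exact: subset_closure.
by rewrite -subset0 -jO; apply: setIS; exact: OS.
Qed.

Section linked.
Variable O : set X.
Hypotheses (Oo : open O) (O0 : O !=set0).
Implicit Types (D : set X) (L : seq (set X)).

Let shrink D V : nowhere_dense D -> open V -> V !=set0 ->
  exists j, B j !=set0 /\ closure (B j) `<=` V `\` D.
Proof.
move=> /nowhere_denseP Dnwd Vo V0; have [W Wo [[w Ww] WV WD]] := Dnwd V Vo V0.
have [j Bjw BjW] := Bbase (open_nbhs_nbhs (conj Wo Ww)).
exists j; split; first by exists w.
move=> x /BjW Wx; split; first exact: WV.
by move=> Dx; have : (W `&` D) x by []; rewrite WD.
Qed.

(** Between two consecutive levels there is room to shrink every earlier basic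
    set off [D]. *)
Let levels D : exists k : nat -> nat, nowhere_dense D ->
  [/\ forall m, (k m <= k m.+1)%N,
      exists j, [/\ (j <= k 0)%N, B j !=set0 & closure (B j) `<=` O `\` D]
    & forall m i, (i <= k m)%N -> B i !=set0 ->
        exists j, [/\ (j <= k m.+1)%N, B j !=set0 &
          closure (B j) `<=` B i `\` D]].
Proof.
have [Dnwd|nD] := pselect (nowhere_dense D); last by exists (fun=> 0%N).
have [j0 [j00 j0O]] := shrink Dnwd Oo O0.
have /choice[b bP] a : exists b, forall i, (i <= a)%N -> B i !=set0 ->
    exists j, [/\ (j <= b)%N, B j !=set0 & closure (B j) `<=` B i `\` D].
  have /choice[h hP] i : exists j, B i !=set0 ->
      B j !=set0 /\ closure (B j) `<=` B i `\` D.
    have [Bi0|nBi] := pselect (B i !=set0); last by exists 0%N.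
    by have [j jP] := shrink Dnwd (Bo i) Bi0; exists j.
  exists (\max_(i < a.+1) h i) => i ia Bi0; exists (h i).
  have [? ?] := hP i Bi0; split=> //.
  exact: (@leq_bigmax _ (fun i : 'I_a.+1 => h i) (Ordinal (ia : (i < a.+1)%N))).
pose k := fix k m := if m is l.+1 then maxn (k l) (b (k l)) else j0.
exists k => _; split=> [m||m i ikm Bi0]; first exact: leq_maxl.
  by exists j0.
have [j [jb Bj0 BjD]] := bP _ _ ikm Bi0; exists j; split=> //.
by rewrite /= leq_max jb orbT.
Qed.

Let argmax (f : set X -> nat) L : L != [::] ->
  exists2 D, D \in L & forall D', D' \in L -> (f D' <= f D)%N.
Proof.
elim: L => // D [|D1 L] IH _.
  by exists D; rewrite ?mem_head // => D'; rewrite inE => /eqP ->.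
have [//|D2 D2L D2max] := IH; have [lt|le] := leqP (f D) (f D2).
  exists D2; first by rewrite inE D2L orbT.
  by move=> D'; rewrite inE => /predU1P[->|/D2max].
exists D; first exact: mem_head.
move=> D'; rewrite inE => /predU1P[-> //|/D2max D'2].
exact: leq_trans D'2 (ltnW le).
Qed.

(** Van Douwen's linked systems: [closure (B j)] is a part of [K D] when
    it lies in [O `\` D] and [j] is at most the level [k D n].  A list is
    handled by treating last the set with the highest level: below that level
    there is a basic set that works for the others, and one more level of that
    set suffices to shrink it. *)
Lemma linked_system n : exists K : set X -> set X,
  (forall D, nowhere_dense D -> closed (K D) /\ K D `<=` O `\` D) /\
  forall L, (forall D, D \in L -> nowhere_dense D) -> (size L <= n.+1)%N ->
    exists x, forall D, D \in L -> K D x.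
Proof.
have [k kP] := choice levels.
pose K m D :=
  \bigcup_(j in [set j | (j <= k D m)%N /\ closure (B j) `<=` O `\` D])
    closure (B j).
have KS m D : nowhere_dense D -> K m D `<=` K m.+1 D.
  move=> /kP[kS _ _] x [j [jk jO] jx]; exists j => //; split=> //.
  exact: leq_trans jk (kS m).
have k0 m D : nowhere_dense D -> (k D 0 <= k D m)%N.
  move=> /kP[kS _ _]; elim: m => // m IH; exact: leq_trans IH (kS m).
have one m D : nowhere_dense D ->
    exists j, [/\ B j !=set0, (j <= k D m)%N &
      B j `<=` closure (B j) /\ closure (B j) `<=` K m D].
  move=> Dnwd; have [_ [j [jk Bj0 BjO]] _] := kP D Dnwd.
  have jm := leq_trans jk (k0 m D Dnwd).
  exists j; split=> //; split; first exact: subset_closure.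
  by move=> x jx; exists j.
have main m L : L != [::] ->
    (forall D, D \in L -> nowhere_dense D) -> (size L <= m.+1)%N ->
    exists j, [/\ B j !=set0, exists2 D, D \in L & (j <= k D m)%N &
      forall D, D \in L -> B j `<=` K m D].
  elim: m L => [|m IH] L L0 Lnwd szL.
    case: L L0 Lnwd szL => [//|D [|//]] _ Lnwd _.
    have [j [Bj0 jk [BjB BjK]]] := one 0%N D (Lnwd _ (mem_head _ _)).
    exists j; split=> //; first by exists D; rewrite ?mem_head.
    by move=> D'; rewrite inE => /eqP ->; exact: subset_trans BjK.
  have [D DL Dmax] := argmax (fun D => k D m) L0.
  have Lrem D' : D' \in L -> D' = D \/ D' \in rem D L.
    by rewrite (perm_mem (perm_to_rem DL)) inE => /predU1P.
  have Dnwd := Lnwd D DL; have [rem0|rem0] := eqVneq (rem D L) [::].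
    have [j [Bj0 jk [BjB BjK]]] := one m.+1 D Dnwd.
    exists j; split=> //; first by exists D.
    by move=> D' /Lrem[->|]; [exact: subset_trans BjK|rewrite rem0].
  have [||j [Bj0 [D0 D0L jk0] jK]] := IH _ rem0.
  - by move=> D' /mem_rem /Lnwd.
  - by rewrite size_rem //; case: (size L) szL.
  have jD : (j <= k D m)%N by apply: leq_trans jk0 _; exact/Dmax/mem_rem/D0L.
  have [_ _ /(_ m j jD Bj0)[i [ik Bi0 BiD]]] := kP D Dnwd.
  have BiBj : B i `<=` B j by move=> x ix; have [] := BiD x (subset_closure ix).
  exists i; split=> //; first by exists D.
  move=> D' /Lrem[->|D'L x /BiBj /(jK _ D'L)]; last exact/KS/Lnwd/mem_rem/D'L.
  move=> x ix; exists i; last exact: subset_closure.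
  split=> // z /BiD[Bjz nDz]; split=> //.
  by have [l [_ lO] /lO[]] := jK _ D0L z Bjz.
exists (K n); split=> [D Dnwd|L Lnwd szL].
  split; last by move=> x [j [_ jO] /jO].
  apply: closed_bigcup; last by move=> j _; exact: closed_closure.
  by apply: (@sub_finite_set _ _ `I_(k D n).+1) => // j [].
have [->|L0] := eqVneq L [::]; first by have [x _] := O0; exists x.
have [j [[x jx] _ jK]] := main n L L0 Lnwd szL.
by exists x => D DL; exact: (jK D DL).
Qed.

End linked.

Hypothesis normX : normal_space X.

(** Linked systems in the sets of a sequence of open sets that vanishes locally
    are glued: since the [n]-th system handles lists of length at most [n.+1],
    every finite list is handled by one of them, while local finiteness keeps
    the closure of the union for [D] disjoint from [D].  Urysohn's
    lemma then turns the separation into a continuous function. *)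
Lemma remote_functions : ~ compact [set: X] ->
  exists phi : set X -> X -> R,
    (forall D, unit_maps (phi D)) /\
    (forall D, closed D -> nowhere_dense D -> forall x, D x -> phi D x = 1%R) /\
    forall L : seq (set X), (forall D, D \in L -> closed D /\ nowhere_dense D) ->
      exists x, forall D, D \in L -> phi D x = 0%R.
Proof.
move=> /noncompact_vanishing[P [Po Pfin]].
have /choice[K KP] := fun n => linked_system (Po n).1 (Po n).2 n.
pose Z D := closure (\bigcup_n K n D).
have ZD D : closed D -> nowhere_dense D -> Z D `&` D = set0.
  move=> Dcl Dnwd; apply/seteqP; split=> // x [Zx Dx].
  have [V Vx [m VP]] := Pfin x.
  have KD n : closed (K n D) /\ K n D `<=` P n `\` D by have [+ _] := KP n; apply.
  have cl : closed (\bigcup_(n in `I_m) K n D).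
    by apply: closed_bigcup => // n _; have [] := KD n.
  have nx : nbhs x (~` \bigcup_(n in `I_m) K n D).
    apply: open_nbhs_nbhs; split; first exact: closed_openC.
    by move=> [n _ nx]; have [_ /(_ _ nx)[]] := KD n.
  have [y [[n _ ny] [Vy my]]] := Zx _ (filterI Vx nx).
  have [nm|mn] := ltnP n m; first by apply: my; exists n.
  have [_ /(_ _ ny)[Py _]] := KD n.
  by have : (V `&` P n) y by []; rewrite VP.
have /choice[phi phiP] D : exists f : X -> R,
    unit_maps f /\ (closed D -> nowhere_dense D ->
    (forall x, Z D x -> f x = 0%R) /\ (forall x, D x -> f x = 1%R)).
  have [[Dcl Dnwd]|nD] := pselect (closed D /\ nowhere_dense D).
    have /(normal_separatorP (R := R)) sep := normX.
    have := sep _ _ (@closed_closure _ _) Dcl (ZD D Dcl Dnwd).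
    move=> /(uniform_separatorP (R := R))[f [fc f01 f0 f1]]; exists f; split.
      split=> // x; have : `[0%R, 1%R]%classic (f x) by apply: f01; exists x.
      by rewrite /= in_itv.
    move=> _ _; split=> x.
      by move=> Zx; apply: f0; exists x.
    by move=> Dx; apply: f1; exists x.
  exists (fun=> 0%R); split=> [|Dcl Dnwd]; last by case: nD.
  by split=> [x|x]; [exact: cvg_cst|rewrite lexx ler01].
exists phi; split=> [D|]; first by have [] := phiP D.
split=> [D Dcl Dnwd|L Lnwd]; first by have [_ /(_ Dcl Dnwd)[]] := phiP D.
have [_ Klinked] := KP (size L).
have [|//|x xK] := Klinked L; first by move=> D /Lnwd[].
exists x => D DL; have [Dcl Dnwd] := Lnwd D DL.
have [_ /(_ Dcl Dnwd)[+ _]] := phiP D; apply.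
by apply: subset_closure; exists (size L) => //; exact: xK.
Qed.

End remote_functions.

(** * The compactification *)
Section stone_cech_facts.
Variables (R : realType) (X : topologicalType).
Notation SC := (stone_cech R X).
Notation cube :=
  (prod_topology (fun _ : @unit_maps R X => R : topologicalType)).
Notation eta := (@stone_cech_unit R X).
Local Open Scope ring_scope.

Lemma stone_cech_nbhs (p : SC) (V : set SC) : nbhs p V <->
  exists W : set cube, [/\ open W, W (\val p) & \val @^-1` W `<=` V].
Proof.
split=> [[_ [[W Wo <-] Wp WV]]|[W [Wo Wp WV]]]; first by exists W.
by exists (\val @^-1` W); split=> //; exists W.
Qed.

Let cube_hausdorff : hausdorff_space cube.
Proof. by apply: hausdorff_product => _; exact: Rhausdorff. Qed.

Lemma stone_cech_compact : compact [set: SC].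
Proof.
pose I01 := [set f : cube | forall i, `[0%R, 1%R]%classic (f i)].
have I01c : compact I01.
  refine (@tychonoff _ (fun _ : @unit_maps R X => R : topologicalType)
    (fun=> `[0%R, 1%R]%classic) (fun=> _)).
  exact: segment_compact.
have SCc : compact (closure (range (@stone_cech_eval R X))).
  apply: (subclosed_compact _ I01c); first exact: closed_closure.
  have -> : I01 = closure I01.
    by apply/closure_id; exact: compact_closed cube_hausdorff I01c.
  apply: closureS => _ [x _ <-] i.
  by have [_ /(_ x)] := set_valP i; rewrite /= in_itv.
move=> F FF _; have [|q [SCq Fq]] := SCc (\val @ F) _.
  exact: (@filterS _ F _ setT _ (fun p _ => set_valP p) filterT).
exists (exist _ q (mem_set SCq)); split=> // A V FA /stone_cech_nbhs[W [Wo Wq WV]].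
have FA' : F [set p : SC | (@image SC cube A \val) (\val p)].
  by apply: (@filterS _ F _ A) => // p Ap; exists p.
have [_ [[p Ap <-] Wp]] := Fq _ W FA' (open_nbhs_nbhs (conj Wo Wq)).
by exists p; split=> //; exact: WV.
Qed.

Lemma stone_cech_coord (f : @unit_maps R X) : continuous (fun p : SC => \val p f).
Proof.
move=> p V Vp; suff : nbhs p [set q : SC | V (\val q f)] by [].
apply/stone_cech_nbhs.
have : nbhs (\val p : cube) [set g : cube | V (g f)].
  exact: (@proj_continuous _ (fun=> R) f (\val p) V Vp).
by rewrite nbhsE => -[W [Wo Wp] WV]; exists W; split=> // q /WV.
Qed.

Lemma stone_cech_hausdorff : hausdorff_space SC.
Proof.
move=> p q pq; apply: val_inj; apply: cube_hausdorff => V W.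
rewrite !nbhsE => -[V' [V'o V'p] V'V] [W' [W'o W'q] W'W].
have [||r [V'r W'r]] :=
  pq ((\val : SC -> cube) @^-1` V') ((\val : SC -> cube) @^-1` W').
- by apply/stone_cech_nbhs; exists V'; split.
- by apply/stone_cech_nbhs; exists W'; split.
by exists (\val r); split; [exact: V'V|exact: W'W].
Qed.

Lemma stone_cech_unit_continuous : continuous eta.
Proof.
move=> x V /stone_cech_nbhs[W [Wo Wx WV]].
have : @stone_cech_eval R X @ x --> (@stone_cech_eval R X x : cube).
  apply/cvg_sup => f U [_ [[U' U'o <-] U'x U'U]].
  apply: (filterS U'U); have [fc _] := set_valP f.
  exact: (fc x U' (open_nbhs_nbhs (conj U'o U'x))).
move=> /(_ W (open_nbhs_nbhs (conj Wo Wx))) nW.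
exact: (@filterS _ (nbhs x) _ _ _ (fun y => WV (eta y)) nW).
Qed.

Lemma stone_cech_unit_dense (V : set SC) : open V -> V !=set0 ->
  exists x, V (eta x).
Proof.
move=> Vo [p Vp].
have /stone_cech_nbhs[W [Wo Wp WV]] := open_nbhs_nbhs (conj Vo Vp).
have [_ [[x _ <-] Wx]] := set_valP p W (open_nbhs_nbhs (conj Wo Wp)).
by exists x; exact: WV.
Qed.

End stone_cech_facts.

(** * Remote closed sets *)
Section remote_closed_sets.
Variables (R : realType) (X : topologicalType).
Hypotheses (crX : crowded X) (sepX : separable X) (metX : metrizable R X).
Notation SC := (stone_cech R X).
Notation eta := (@stone_cech_unit R X).

Let coord_fiber_closed (f : @unit_maps R X) (r : R) (q : SC) :
  closure [set q : SC | \val q f = r] q -> \val q f = r.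
Proof.
have : closed ((fun q : SC => \val q f) @^-1` [set r]); last by apply.
apply: closed_comp => [? _|]; first exact: stone_cech_coord.
exact: accessible_closed_set1 (hausdorff_accessible (@Rhausdorff R)) r.
Qed.

Section lower_bound.
Variables (F : set SC) (U : set (set SC)).
Hypotheses (F0 : F !=set0) (Fcl : closed F) (Frem : remote_set F).
Hypotheses (Uo : U `<=` open)
  (UF : F = \bigcap_(V in [set V | U V /\ F `<=` V]) V).

(** Singletons are nowhere dense, as the space is crowded. *)
Let remote_unit x : ~ F (eta x).
Proof.
move=> Fx; have xnwd : nowhere_dense [set x].
  apply: (crowded_nowhere_dense metX crX) => y; exists setT; first exact: filterT.
  by rewrite setTI; exact: finite_set1.
have : (F `&` closure (eta @` [set x])) (eta x).
  by split=> //; apply: subset_closure; exists x.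
by rewrite Frem.
Qed.

(** Otherwise [F] is open and nonempty, and therefore meets the dense set of the
    points of the space, which are not remote. *)
Lemma remote_family_infinite : infinite_set U.
Proof.
move=> Ufin; have Fo : open F.
  rewrite UF -[X in open X]setCK setC_bigcap; apply: closed_openC.
  apply: closed_bigcup => [|V [/Uo Vo _]]; last exact: open_closedC.
  by apply: sub_finite_set Ufin => V [].
have [x] := stone_cech_unit_dense Fo F0; exact: remote_unit.
Qed.

(** For a finite list [l] of members of [U], let [Wl l] be the intersection of
    slightly smaller neighbourhoods of [F], and let [f l n] be the index of a
    point of a dense sequence that lies in [Wl l] and outside [H n].  Given [g],
    the points outside [H n] of index less than [g n] form, for all [n]
    together, a locally finite and thus nowhere dense set; its closure misses
    [F], hence by compactness it misses some [Wl l].  This says that the point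
    of index [f l n] is not among them, that is, [g n <= f l n] for all [n]. *)
Lemma remote_dominating : exists2 D : set baire_space, D #<= U &
  forall g : baire_space, exists2 f, D f & forall n, (g n <= f n)%N.
Proof.
have SCc := @stone_cech_compact R X; have SCh := @stone_cech_hausdorff R X.
have X0 : [set: X] !=set0.
  have [x _] :=
    stone_cech_unit_dense openT (subset_nonempty (@subsetT _ F) F0).
  by exists x.
have [p pd] := separable_sequence X0 sepX.
have [B Bo Bbase] := metrizable_base metX X0 sepX.
pose cl j := closure (eta @` B j); pose J := [set j | F `&` cl j = set0].
have Jcover x : exists2 j, J j & B j x.
  have Fx : nbhs (eta x) (~` F).
    by apply: open_nbhs_nbhs; split; [exact: closed_openC|exact: remote_unit].
  have [V Vx VF] := compact_regular SCh SCc filterT Fx.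
  have [j Bjx BjV] := Bbase x _ (stone_cech_unit_continuous Vx).
  exists j => //; apply/seteqP; split=> // q [Fq jq].
  have /VF : closure V q; last by [].
  apply: closureS jq => _ [y jy <-]; apply: BjV; exact: subset_closure.
(* [H n] increases to X, and its closure in the compactification misses F *)
pose H n := \bigcup_(j in [set j | (j < n)%N /\ J j]) B j.
pose Hcl n := \bigcup_(j in [set j | (j < n)%N /\ J j]) cl j.
have Hclc n : closed (Hcl n).
  apply: closed_bigcup; last by move=> j _; exact: closed_closure.
  by apply: (@sub_finite_set _ _ `I_n) => // j [].
have HclF n q : F q -> ~ Hcl n q.
  by move=> Fq [j [_ Jj] jq]; have : (F `&` cl j) q by []; rewrite Jj.
have HHcl n x : H n x -> Hcl n (eta x).
  by move=> [j jJ jx]; exists j => //; apply: subset_closure; exists x.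
(* compactness needs closed sets, and the members of [U] are open: [W V] is a
   neighbourhood of F with closure in V *)
have /choice[W WP] V : exists W,
    [/\ open W, F `<=` W & U V -> F `<=` V -> closure W `<=` V].
  have [[UV FV]|nV] := pselect (U V /\ F `<=` V); last first.
    by exists setT; split=> // [|UV FV]; [exact: openT|case: nV].
  have [|W' /set_nbhsP[W [Wo FW WW']] W'V] :=
    @compact_normal SC SCh SCc F Fcl V _.
    by apply/set_nbhsP; exists V; split=> //; exact: Uo.
  exists W; split=> // _ _; apply: subset_trans W'V; exact: closureS.
pose Wl (l : seq (set SC)) := [set q | forall V, V \in l -> W V q].
have Wlo l : open (Wl l).
  elim: l => [|V l IH].
    by rewrite (_ : Wl _ = setT) ?predeqE //; exact: openT.
  rewrite (_ : Wl _ = W V `&` Wl l).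
    by apply: openI => //; have [] := WP V.
  apply/seteqP; split=> [q Vlq|q [Vq lq] V']; last first.
    by rewrite inE => /predU1P[->|/lq].
  split=> [|V' V'l]; apply: Vlq; rewrite inE ?eqxx // V'l orbT //.
have FWl l : F `<=` Wl l by move=> q Fq V _; have [_ + _] := WP V; apply.
(* the set F itself witnesses that [Wl l] is not covered by the closure of [H n] *)
have /choice[h hP] (ln : seq (set SC) * nat) :
    exists j, Wl ln.1 (eta (p j)) /\ ~ H ln.2 (p j).
  have oWl : open (Wl ln.1 `&` ~` Hcl ln.2).
    by apply: openI => //; exact: closed_openC.
  have [q Fq] := F0.
  have [||j [lj nHj]] := pd (eta @^-1` (Wl ln.1 `&` ~` Hcl ln.2)).
  - apply: open_comp => // x _; exact: stone_cech_unit_continuous.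
  - apply: stone_cech_unit_dense => //.
    by exists q; split; [exact: FWl|exact: HclF].
  by exists j; split=> // /HHcl.
pose f l : baire_space := fun n => h (l, n).
exists (f @` [set l | forall V, V \in l -> U V]).
  apply: card_le_trans (card_image_le _ _) _.
  exact: card_seq_infinite remote_family_infinite.
move=> g; pose E := [set x | exists n j, [/\ (j < g n)%N, ~ H n (p j) & x = p j]].
have Enwd : nowhere_dense E.
  apply: (crowded_nowhere_dense metX crX) => x; have [i Ji Bix] := Jcover x.
  exists (B i); first exact: open_nbhs_nbhs.
  apply: (@sub_finite_set _ _ (\bigcup_(n in `I_i.+1) p @` `I_(g n))).
    move=> y [iy [n [j [jn nHj yE]]]]; rewrite yE in iy *.
    exists n; last by exists j.
    by rewrite /= ltnS leqNgt; apply/negP => ltin; apply: nHj; exists i.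
  by apply: bigcup_finite => // n _; exact: finite_image.
have [l lU lE] : exists2 l : seq (set SC),
    (forall V, V \in l -> U V) & Wl l `&` eta @` E = set0.
  apply: contrapT => nol.
  (* a cluster point of this filter lies in F and in the closure of E *)
  pose Phi (A : set SC) := exists2 l : seq (set SC),
    (forall V, V \in l -> U V) & Wl l `&` eta @` E `<=` A.
  have PhiF : ProperFilter Phi.
    apply: Build_ProperFilter => [[l lU lE]|].
      by apply: nol; exists l => //; rewrite -subset0.
    split=> [|A A' [l lU lA] [l' lU' lA']|A A' AA' [l lU lA]].
    - by exists [::].
    - exists (l ++ l') => [V|q [ll' Eq]].
        by rewrite mem_cat => /orP[/lU|/lU'].
      split; [apply: lA|apply: lA']; split=> // V Vl; apply: ll';
        by rewrite mem_cat Vl ?orbT.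
    - by exists l => //; exact: subset_trans AA'.
  have [|q [_ Phiq]] := SCc Phi PhiF; first by exists [::].
  have : (F `&` closure (eta @` E)) q; last by rewrite Frem.
  split; last by move=> A Aq; apply: Phiq => //; exists [::] => // ? [].
  rewrite UF => V [UV FV]; have [_ _ WV] := WP V; apply: WV => // A Aq.
  apply: Phiq => //; exists [:: V] => [V'|q' [+ _]].
    by rewrite inE => /eqP ->.
  by apply; exact: mem_head.
exists (f l); first by exists l.
move=> n; rewrite leqNgt; apply/negP => fg; have [lh nh] := hP (l, n).
have : (Wl l `&` eta @` E) (eta (p (h (l, n)))).
  by split=> //; exists (p (h (l, n))) => //; exists n, (h (l, n)).
by rewrite lE.
Qed.

End lower_bound.

(** The members [A] of [C], the indices [k] of their nowhere dense parts and the
    finite sequences [t] decode to closed nowhere dense sets [D (A, k, t)] that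
    are cofinal among the nowhere dense sets.  Let [F] be the set of common zeros
    of the extensions of their remote functions: it is nonempty because finitely
    many of these functions have a common zero, it is remote because the
    function of [D i] equals 1 on [D i], and it is cut out by the conditions
    that one of these functions has absolute value less than [e.+1^-1], of which
    there are countably many for each [A]. *)
Lemma remote_of_cofinal (C : set (set baire_space)) :
  ~ compact [set: X] -> C `<=` @meager baire_space ->
  (forall A, meager A -> exists2 B, C B & A `<=` B) ->
  exists2 F : set SC, [/\ F !=set0, closed F & remote_set F] &
    exists U : set (set SC), [/\ U #<= C, U `<=` open &
      F = \bigcap_(V in [set V | U V /\ F `<=` V]) V].
Proof.
move=> ncX Cm Ccof.
have X0 : [set: X] !=set0.
  apply/set0P/eqP => X0; apply: ncX; rewrite X0; exact: compact0.
have [B Bo Bbase] := metrizable_base metX X0 sepX.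
have Bpi (V : set X) : open V -> V !=set0 -> exists2 j, B j !=set0 & B j `<=` V.
  move=> Vo [v Vv]; have [j jv jV] := Bbase v V (open_nbhs_nbhs (conj Vo Vv)).
  by exists j; [exists v|exact: subset_trans (@subset_closure _ _) jV].
have [phi [phi01 [phi1 phi0]]] :=
  @remote_functions R X B Bo Bbase (metrizable_normal metX) ncX.
have /choice[part partP] A : exists N : nat -> set baire_space, C A ->
    (forall k, nowhere_dense (N k)) /\ A = \bigcup_k N k.
  have [/Cm[N Nnwd NA]|nA] := pselect (C A); last by exists (fun=> set0).
  by exists N.
pose D (i : set baire_space * nat * seq nat) : set X :=
  decode B (part i.1.1 i.1.2) i.2.
have Dcl i : closed (D i) by exact: decode_closed.
have Dnwd i : C i.1.1 -> nowhere_dense (D i).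
  by move=> /partP[Nnwd _]; exact: decode_nowhere_dense.
pose c i : @unit_maps R X := exist _ (phi (D i)) (mem_set (phi01 (D i))).
pose F : set SC := [set q | forall i, C i.1.1 -> \val q (c i) = 0%R].
have FE e i : C i.1.1 -> F `<=` [set q | (`|\val q (c i)| < e.+1%:R^-1)%R].
  by move=> Ci q Fq /=; rewrite Fq // normr0 invr_gt0 ltr0n.
have Fcl : closed F.
  move=> q Fq i Ci; apply: coord_fiber_closed => V /Fq[q' [Fq' Vq']].
  by exists q'; split=> //; exact: Fq'.
exists F.
  split=> //; last first.
    move=> N Nnwd; have cN : meager (code B N).
      exists (fun=> code B N); last by rewrite bigcup_const.
      by move=> _; exact: code_nowhere_dense.
    have [A CA NA] := Ccof _ cN; have [_ AE] := partP A CA.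
    rewrite AE in NA; have [k [t Nkt]] := decode_code X0 Bo Bpi Nnwd NA.
    apply/seteqP; split=> // q [Fq Nq].
    pose i := (A, k, t); have : \val q (c i) = 1%R.
      apply: coord_fiber_closed; apply: closureS Nq => _ [x Nx <-] /=.
      by apply: phi1 => //; [exact: Dnwd|exact: Nkt].
    by rewrite Fq // => /eqP; rewrite eq_sym oner_eq0.
  pose Phi (A : set SC) := exists2 l : seq (set X),
    (forall E, E \in l -> closed E /\ nowhere_dense E) &
    eta @` [set x | forall E, E \in l -> phi E x = 0%R] `<=` A.
  have PhiF : ProperFilter Phi.
    apply: Build_ProperFilter => [[l lU l0]|].
      by have [x xl] := phi0 l lU; apply: (l0 (eta x)); exists x.
    split=> [|A A' [l lU lA] [l' lU' lA']|A A' AA' [l lU lA]].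
    - by exists [::].
    - exists (l ++ l') => [V|_ [x xl <-]].
        by rewrite mem_cat => /orP[/lU|/lU'].
      split; [apply: lA|apply: lA']; exists x => // V Vl; apply: xl;
        by rewrite mem_cat Vl ?orbT.
    - by exists l => //; exact: subset_trans AA'.
  have [|q [_ Phiq]] := @stone_cech_compact R X Phi PhiF; first by exists [::].
  exists q => i Ci.
  apply: coord_fiber_closed => V Vq; apply: Phiq => //; exists [:: D i].
    by move=> E; rewrite inE => /eqP ->; split; [exact: Dcl|exact: Dnwd].
  by move=> _ [x xi <-]; apply: xi; exact: mem_head.
pose nbd (An : set baire_space * nat) : set SC :=
  if unpickle An.2 is Some (k, t, e) then
    [set q | (`|\val q (c (An.1, k, t))| < e.+1%:R^-1)%R] else setT.
exists (nbd @` (C `*` [set: nat])); split.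
- apply: card_le_trans (card_image_le _ _) (card_setX_nat _).
  exact: cofinal_meager_infinite.
- move=> _ [[A n] _ <-]; rewrite /nbd /=.
  case: unpickle => [[[k t] e]|]; last exact: openT.
  apply: (@open_comp _ _ (fun q : SC => `|\val q (c (A, k, t))|%R)
    [set r | (r < e.+1%:R^-1)%R]).
    by move=> q _; exact: (cvg_norm (@stone_cech_coord R X (c (A, k, t)) q)).
  exact: open_lt.
apply/seteqP; split=> [q Fq V [_]|q qU [[A k] t] CA]; first exact.
apply: contrapT => /eqP; rewrite -normr_gt0 => q0.
have [e _ eP] := @near_infty_natSinv_lt R (PosNum q0).
have := eP e (leqnn e); rewrite /= ltNge => /negP; apply.
apply: ltW; apply: (qU [set q | (`|\val q (c (A, k, t))| < e.+1%:R^-1)%R]); split.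
  by exists (A, pickle (k, t, e)) => //; rewrite /nbd pickleK.
exact: (FE e (A, k, t)).
Qed.

End remote_closed_sets.

(** * The cardinal inequalities *)
Lemma least_xcard_mem (T : Type) (S : set (xcard T)) A :
  least_xcard S = Some A -> S (Some A).
Proof. by rewrite /least_xcard; case: xgetP => // a -> [Sa _] <-. Qed.

Lemma least_card_mem (T : Type) (P : set (set T)) A :
  least_card P = Some A -> P A.
Proof. by move=> /least_xcard_mem[B PB [<-]]. Qed.

Lemma least_card_le (T : Type) (P : set (set T)) A : P A ->
  exists2 B, least_card P = Some B & B #<= A.
Proof.
move=> PA; have SA : (Some @` P) (Some A) by exists A.
have [_ /(_ _ SA)] := least_xcardP (ex_intro _ _ SA).
by rewrite -/(least_card P); case: least_card => // B BA; exists B.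
Qed.

Theorem corollary3p6 (R : realType) (X : topologicalType)
    (ncX : ~ compact [set: X]) (crX : crowded X) (sepX : separable X)
    (metX : metrizable R X) :
  [/\ xcard_le covM (re R X),
      xcard_le (re R X) cofM
    & xcard_le (xcard_min nonM dominatingN) (re R X)].
Proof.
have dominating U : re R X = Some U -> exists2 D : set baire_space, D #<= U &
    forall g : baire_space, exists2 f, D f & forall n, (g n <= f n)%N.
  move=> /least_xcard_mem[F [F0 Fcl Frem] /least_card_mem[Uo UF]].
  exact: remote_dominating UF.
split.
- case reE: (re R X) => [U|]; last by case: covM.
  have [D DU Ddom] := dominating U reE.
  pose below (f : baire_space) : set baire_space :=
    [set y | forall n, (y n <= f n)%N].
  have [|C cE CD] := @least_card_le _ [set C | C `<=` @meager baire_space /\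
      \bigcup_(A in C) A = [set: baire_space]] (below @` D); last first.
    rewrite [covM]cE.
    exact: card_le_trans CD (card_le_trans (card_image_le _ _) DU).
  split=> [_ [f Df <-]|].
    (* exceeding [f] at the next place leaves the set *)
    exists (fun=> below f); last by rewrite bigcup_const.
    move=> _; apply/nowhere_dense_cylinder => s; exists [:: (f (size s)).+1].
    apply/seteqP; split=> // y [sy /(_ (size s))].
    by rewrite sy ?size_cat ?addn1 // nth_cat ltnn subnn ltnn.
  apply/seteqP; split=> // y _; have [f Df yf] := Ddom y.
  by exists (below f) => //; exists f.
- case cofE: cofM => [C|]; last by case: (re R X).
  have [Cm Ccof] := least_card_mem cofE.
  have [F Fremote [U [UC Uo UF]]] := remote_of_cofinal sepX metX ncX Cm Ccof.
  have [V VE VU] : exists2 V, closed_character F = Some V & V #<= U.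
    exact: least_card_le (conj Uo UF).
  have SF : [set closed_character F | F in [set F : set (stone_cech R X) |
      [/\ F !=set0, closed F & remote_set F]]] (Some V) by exists F.
  have [_ /(_ _ SF)] := least_xcardP (ex_intro _ _ SF).
  rewrite -/(re R X); case: (re R X) => // W WV.
  exact: card_le_trans WV (card_le_trans VU UC).
- case reE: (re R X) => [U|]; last by case: xcard_min.
  have [D DU Ddom] := dominating U reE.
  have [|E EE ED] := @least_card_le _ [set D : set baire_space |
      forall f, exists2 g, D g & le_star f g] D.
    move=> g; have [f Df gf] := Ddom g; exists f => //.
    rewrite /le_star (_ : [set n | _] = set0); first exact: finite_set0.
    by apply/seteqP; split=> // n /=; rewrite ltnNge gf.
  have dE : dominatingN = Some E by [].
  have EU := card_le_trans ED DU.
  rewrite /xcard_min dE; case: asboolP => //.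
  by case: nonM => // N NE; exact: card_le_trans NE EU.
Qed.
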